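(* Let $\mathbf{P}(x)=(p_0(x)\;\;p_1(x)\;\;p_2(x)\;\cdots)$ be the orthogonal polynomials with respect to $\lambda$, with multiplication matrix $X_P$ (so $x\mathbf{P}(x)=\mathbf{P}(x)X_P$), and let $W_P=\int_{\mathbb{R}}\mathbf{P}(x)^\top\mathbf{P}(x)\,\mathrm{d}\mu(x)$ be the Gram matrix of $\mathbf{P}$ with respect to the measure $\mu$. Let $n\ge 1$. If $$G=\bigl(e_n \,\big|\, -P_nW_Pe_{n+1}(X_P)_{n+1,n}\bigr)\in\mathbb{R}^{n\times 2}\quad\text{and}\quad J=\begin{pmatrix}0&1\\-1&0\end{pmatrix},$$ then $$(P_nX_P^\top P_n^\top)(P_nW_PP_n^\top)-(P_nW_PP_n^\top)(P_nX_PP_n^\top)=GJG^\top.$$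
   Context: $\lambda$ and $\mu$ are positive Borel measures on $\mathbb{R}$ whose supports contain infinitely many points and all of whose moments are finite. $\mathbf{P}(x)$ is the row vector of a family of real polynomials, $\deg p_k=k$, orthogonal with respect to $\langle f,g\rangle_\lambda=\int_{\mathbb{R}}f g\,\mathrm{d}\lambda$ (not necessarily normalized). $X_P$ is the (infinite, irreducible, tridiagonal) matrix uniquely determined by $x\mathbf{P}(x)=\mathbf{P}(x)X_P$. Rows and columns of all matrices are indexed from $1$, so the $(i,j)$ entry of $W_P$ is $\int_{\mathbb{R}}p_{i-1}p_{j-1}\,\mathrm{d}\mu$. $P_n=\begin{pmatrix}I_n&0\end{pmatrix}\in\mathbb{R}^{n\times\infty}$ is the projection onto the first $n$ coordinates, where $I_n$ is the $n\times n$ identity. $e_k$ is the $k$-th canonical basis vector (of the size dictated by context: the vector $e_n$ forming the first column of $G$ is in $\mathbb{R}^n$, while $e_{n+1}$ is an infinite vector). $(A\,|\,B)$ denotes the matrix with columns $A$ and $B$. *)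

(* Defs.v *)
From HB Require Import structures.
From mathcomp Require Import all_boot all_order all_algebra.
From mathcomp Require Import all_classical all_reals all_analysis.
Import Order.TTheory GRing.Theory Num.Theory.
Import numFieldNormedType.Exports.
Set Implicit Arguments.
Unset Strict Implicit.
Unset Printing Implicit Defensive.
Local Open Scope classical_set_scope.
Local Open Scope ring_scope.

(* Matrices with arbitrary, possibly infinite, index types. Index [k : nat]
   (or [k : 'I_n]) stands for the 1-based position [k + 1], so that position
   [k] of a row of polynomials holds the polynomial of degree [k]. *)
Definition imx (R I J : Type) := I -> J -> R.

Definition itr (R I J : Type) (A : imx R I J) : imx R J I := fun j i => A i j.

(* The sum over a finite support is the genuine matrix product whenever the
   rows of [A] or the columns of [B] are finitely supported (otherwise an
   infinitely supported sum is 0 by convention). *)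
Definition imul (R : realType) (I J : Type) (K : choiceType)
    (A : imx R I K) (B : imx R K J) : imx R I J :=
  fun i j => \sum_(k \in [set: K]) A i k * B k j.

Definition mx_of_imx (R : realType) (m n : nat) (A : imx R 'I_m 'I_n) :
  'M[R]_(m, n) := \matrix_(i, j) A i j.

Definition projn (R : realType) (n : nat) : imx R 'I_n nat :=
  fun i k => (val i == k)%:R.

Arguments projn : clear implicits.

(* [P_n A P_n^T] *)
Definition trunc (R : realType) (n : nat) (A : imx R nat nat) : 'M[R]_n :=
  mx_of_imx (imul (imul (projn R n) A) (itr (projn R n))).

(* Canonical basis vectors, with [k] counted from 1. *)
Definition evec (R : realType) (n k : nat) : 'cV[R]_n :=
  \col_(i < n) (i.+1 == k)%:R.

Definition evec_inf (R : realType) (k : nat) : imx R nat 'I_1 :=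
  fun i _ => (i.+1 == k)%:R.

Definition measure_support (R : realType)
    (mu : {measure set (measurableTypeR R) -> \bar R}) : set R :=
  [set x | forall U : set R, open U -> U x -> (0 < mu U)%E].

Definition finite_moments (R : realType)
    (mu : {measure set (measurableTypeR R) -> \bar R}) : Prop :=
  forall k : nat, mu.-integrable [set: R] (fun x : R => (x ^+ k)%:E).

Definition inner (R : realType)
    (mu : {measure set (measurableTypeR R) -> \bar R}) (f g : {poly R}) : R :=
  \int[mu]_x (f.[x] * g.[x]).

Definition orthogonal_polynomials (R : realType)
    (mu : {measure set (measurableTypeR R) -> \bar R})
    (p : nat -> {poly R}) : Prop :=
  (forall k, size (p k) = k.+1) /\
  (forall i j, i != j -> inner mu (p i) (p j) = 0).

Definition polyrow (R : realType) (p : nat -> {poly R}) (x : R) :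
  imx R unit nat := fun _ k => (p k).[x].

(* [x P(x) = P(x) X]; finitely supported columns make the product on the right
   meaningful. Tridiagonality and irreducibility of [X] are consequences of
   this when [p] is orthogonal for a measure of infinite support. *)
Definition multiplication_matrix (R : realType) (p : nat -> {poly R})
    (X : imx R nat nat) : Prop :=
  (forall j, finite_set [set i | X i j != 0]) /\
  (forall (x : R) u j,
    x * polyrow p x u j = imul (polyrow p x) X u j).

Definition gram (R : realType)
    (mu : {measure set (measurableTypeR R) -> \bar R})
    (p : nat -> {poly R}) : imx R nat nat :=
  fun i j => inner mu (p i) (p j).

(* Since indices start at 0, the 1-based entry [(X)_{n+1,n}] is [X n n.-1]. *)
Definition Gmx (R : realType) (n : nat) (X W : imx R nat nat) : 'M[R]_(n, 2) :=
  row_mx (evec R n n)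
    (- (X n n.-1 *:
        mx_of_imx (imul (imul (projn R n) W) (evec_inf R n.+1)))).

Definition Jmx (R : realType) : 'M[R]_2 :=
  block_mx (0 : 'M[R]_1) (1%:M : 'M[R]_1) ((-1)%:M : 'M[R]_1) (0 : 'M[R]_1).

(* Main.v *)
(** Multiplication by [x] is symmetric for the bilinear form of [mu], that is
    [X^T W = W X] for the infinite matrices. As [X] is upper Hessenberg (because
    [deg (x p_j) = j + 1]), cutting these products at order [n] discards a single
    term in each, coming from the entry [X_(n+1,n)]; the two terms form the rank
    two matrix [G J G^T]. *)

Require Import Defs.
From HB Require Import structures.
From mathcomp Require Import all_boot all_order all_algebra.
From mathcomp Require Import all_classical all_reals all_analysis.
From mathcomp Require Import ring.
Import Order.TTheory GRing.Theory Num.Theory.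
Import numFieldNormedType.Exports.
Local Open Scope classical_set_scope.
Local Open Scope ring_scope.

(** A nonzero difference would vanish at the pairwise distinct points 0, 1, 2, ..., as many of them
    as its size, one more than its degree allows. *)
Lemma poly_ext (R : numDomainType) (p q : {poly R}) :
  (forall x, p.[x] = q.[x]) -> p = q.
Proof.
move=> pq; apply/eqP; rewrite -subr_eq0; apply/negP => /negP d_neq0.
have roots : all (root (p - q)) [seq i%:R | i <- iota 0 (size (p - q))].
  by apply/allP => x _; rewrite /root hornerD hornerN pq subrr.
have := max_poly_roots d_neq0 roots.
rewrite map_inj_uniq ?iota_uniq; last by move=> a b /eqP; rewrite eqr_nat => /eqP.
by rewrite size_map size_iota ltnn => /(_ isT).
Qed.

Section GradedPolynomials.
Variables (R : idomainType) (p : nat -> {poly R}).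
Hypothesis size_p : forall k, size (p k) = k.+1.

(** Elimination from the top: only [p N] reaches degree [N], so the coefficient of degree [N] is
    [c N] times a nonzero leading coefficient. If [m <= N] it vanishes, hence so does [c N], and the
    sum gets shorter. *)
Lemma graded_coef_eq0 (c : nat -> R) (m N : nat) :
  (size (\sum_(k < N) c k *: p k)%R <= m)%N ->
  forall k, (m <= k < N)%N -> c k = 0.
Proof.
elim: N => [_ k|N IHN]; first by rewrite andbF.
have [ltNm _ k /andP[lemk]|lemN] := ltnP N m.
  by rewrite ltnS => /(leq_trans lemk); rewrite leqNgt ltNm.
rewrite big_ord_recr /= => szS.
have lowN : (\sum_(k < N) c k *: p k)%R`_N = 0.
  rewrite coef_sum big1 // => k _.
  by rewrite coefZ nth_default ?mulr0 // size_p.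
have cN0 : c N = 0.
  have /eqP : (\sum_(k < N) c k *: p k + c N *: p N)%R`_N = 0.
    by rewrite nth_default // (leq_trans szS).
  rewrite coefD lowN add0r coefZ mulf_eq0 => /orP[/eqP //|].
  have -> : (p N)`_N = lead_coef (p N) by rewrite lead_coefE size_p.
  by rewrite lead_coef_eq0 -size_poly_eq0 size_p.
move=> k; rewrite ltnS (leq_eqVlt k) => /andP[lemk /orP[/eqP-> //|ltkN]].
by apply: IHN; rewrite ?lemk //; rewrite cN0 scale0r addr0 in szS.
Qed.

End GradedPolynomials.

Section InfiniteMatrices.
Variable R : realType.

Lemma imul_ord (I J : Type) (A : imx R I nat) (B : imx R nat J) i j N :
  (forall k, (N <= k)%N -> A i k * B k j = 0) ->
  imul A B i j = \sum_(k < N) A i k * B k j.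
Proof.
move=> AB0; rewrite /imul (fsbig_ord _ N (fun k => A i k * B k j)).
by apply/esym/fsbig_widen => // k [_ /negP]; rewrite -leqNgt => /AB0.
Qed.

Lemma imul_projn n (J : Type) (A : imx R nat J) (i : 'I_n) j :
  imul (projn R n) A i j = A i j.
Proof.
rewrite (@imul_ord _ _ _ _ _ _ n); last first.
  by move=> k lenk; rewrite /projn ltn_eqF ?mul0r // (leq_trans _ lenk) //=.
rewrite (bigD1 i) //= big1 ?addr0 => [|k /negPf neki].
  by rewrite /projn eqxx mul1r.
by rewrite /projn eq_sym -[_ == _]/(k == i) neki mul0r.
Qed.

Lemma truncE n (A : imx R nat nat) (i j : 'I_n) : trunc n A i j = A i j.
Proof.
(* Multiplying by [P_n^T] on the right is multiplying the transpose by [P_n] on the left. *)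
rewrite mxE -[RHS]imul_projn -[RHS](imul_projn _ _ (itr (imul _ A))).
by apply: eq_fsbigr => k _; rewrite mulrC.
Qed.

Lemma imul_evec_inf (I : Type) (A : imx R I nat) i k u :
  imul A (evec_inf R k.+1) i u = A i k.
Proof.
rewrite (@imul_ord _ _ _ _ _ _ k.+1); last first.
  by move=> l ltkl; rewrite /evec_inf eqSS gtn_eqF // mulr0.
rewrite big_ord_recr /= big1 ?add0r => [|l _].
  by rewrite /evec_inf eqxx mulr1.
by rewrite /evec_inf eqSS ltn_eqF // mulr0.
Qed.

(** For [G] with columns [a] and [b], [G J G^T = a b^T - b a^T]. *)
Lemma GJGtE n (X W : imx R nat nat) (i j : 'I_n) :
  (Gmx n X W *m Jmx R *m (Gmx n X W)^T) i j =
  X n n.-1 * (W i n * (j.+1 == n)%:R - (i.+1 == n)%:R * W j n).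
Proof.
rewrite /Gmx /Jmx (@mul_row_block _ n 1 1 1 1) !mulmx0 add0r addr0.
rewrite (@tr_row_mx _ n 1 1) (@mul_row_col _ n 1 1 n).
rewrite mul_mx_scalar mulmx1 scaleN1r opprK !mxE !big_ord1 !mxE.
rewrite !imul_evec_inf !imul_projn; ring.
Qed.

End InfiniteMatrices.

Section Gram.
Variables (R : realType) (mu : {measure set (measurableTypeR R) -> \bar R}).
Hypothesis mu_mom : finite_moments mu.

Lemma integrable_poly (q : {poly R}) :
  mu.-integrable [set: R] (fun x : R => (q.[x])%:E).
Proof.
have -> : (fun x : R => (q.[x])%:E) =
    (fun x : R => \sum_(i < size q) ((q`_i)%:E * (x ^+ i)%:E)%E).
  by apply/funext => x; rewrite horner_coef -sumEFin.
by apply: integrable_sum => // i _; apply: integrableZl.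
Qed.

Lemma innerC (f g : {poly R}) : inner mu f g = inner mu g f.
Proof. by apply: eq_Rintegral => x _; rewrite mulrC. Qed.

Lemma inner_mulX (f g : {poly R}) : inner mu ('X * f) g = inner mu f ('X * g).
Proof. by apply: eq_Rintegral => x _; rewrite !hornerE mulrAC mulrC mulrA. Qed.

Lemma inner_suml N (c : nat -> R) (q : nat -> {poly R}) (g : {poly R}) :
  inner mu (\sum_(k < N) c k *: q k) g = \sum_(k < N) c k * inner mu (q k) g.
Proof.
elim: N => [|N IHN].
  rewrite !big_ord0 -[RHS](mul0r (inner mu 0 0)) -RintegralZl //.
    by apply: eq_Rintegral => x _; rewrite horner0 !mul0r.
  by under eq_fun do rewrite -hornerM; exact: integrable_poly.
rewrite !big_ord_recr /= -IHN -RintegralZl //; last first.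
  by under eq_fun do rewrite -hornerM; exact: integrable_poly.
rewrite -RintegralD //.
- by apply: eq_Rintegral => x _; rewrite hornerD hornerZ mulrDl mulrA.
- by under eq_fun do rewrite -hornerM; exact: integrable_poly.
- under eq_fun do rewrite -hornerM -hornerZ; exact: integrable_poly.
Qed.

End Gram.

Section MultiplicationMatrix.
Variables (R : realType) (p : nat -> {poly R}) (X : imx R nat nat).
Hypothesis size_p : forall k, size (p k) = k.+1.
Hypothesis hX : multiplication_matrix p X.

(** The defining relation of [X] holds at every point [x], hence between polynomials. *)
Lemma mulX_expand j N : (forall k, (N <= k)%N -> X k j = 0) ->
  'X * p j = \sum_(k < N) X k j *: p k.
Proof.
move=> X0; apply: poly_ext => x.
rewrite hornerM hornerX horner_sum.
have /= -> := hX.2 x tt j.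
rewrite (@imul_ord _ _ _ _ _ _ _ N); last by move=> k /X0 ->; rewrite mulr0.
by apply: eq_bigr => k _; rewrite hornerZ mulrC.
Qed.

Lemma multiplication_matrix_hessenberg j k : (j.+1 < k)%N -> X k j = 0.
Proof.
move=> ltjk.
(* Finiteness of the column gives a first, uncontrolled bound [N], enough for a finite expansion of
   ['X * p j]; comparing degrees then sharpens it to [j.+2]. *)
have /finite_seqP[s supp] := hX.1 j.
pose N := (\max_(i <- s) i).+1.
have X0 i : (N <= i)%N -> X i j = 0.
  move=> leNi; apply/eqP; apply: contraTT leNi => Xij.
  have : [set i | X i j != 0] i by [].
  by rewrite supp /= -ltnNge ltnS => si; apply: leq_bigmax_seq.
have [/X0 //|ltkN] := leqP N k.
apply: (@graded_coef_eq0 _ p size_p (X^~ j) j.+2 N); last by rewrite ltjk.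
by rewrite -mulX_expand // mulrC size_mulX ?size_p // -size_poly_eq0 size_p.
Qed.

End MultiplicationMatrix.

Theorem lemma2p6 (R : realType)
  (lambda mu : {measure set (measurableTypeR R) -> \bar R})
  (lambda_supp : infinite_set (measure_support lambda))
  (mu_supp : infinite_set (measure_support mu))
  (lambda_mom : finite_moments lambda)
  (mu_mom : finite_moments mu)
  (p : nat -> {poly R}) (hp : orthogonal_polynomials lambda p)
  (X : imx R nat nat) (hX : multiplication_matrix p X)
  (n : nat) (n_ge1 : (1 <= n)%N) :
  trunc n (itr X) *m trunc n (gram mu p)
    - trunc n (gram mu p) *m trunc n X
  = Gmx n X (gram mu p) *m Jmx R *m (Gmx n X (gram mu p))^T.
Proof.
have hess := @multiplication_matrix_hessenberg _ _ _ hp.1 hX.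
(* As [i < n], the degree is at most [n]: a single term, [k = n], lies beyond the truncation. *)
have expand (i : 'I_n) : 'X * p i = \sum_(k < n.+1) X k i *: p k.
  apply: (mulX_expand _ _ _ hX) => k ltnk.
  by apply: hess; apply: leq_trans ltnk; rewrite ltnS.
(* Among the first [n] columns, only the last one reaches row [n]. *)
have last_row (i : 'I_n) : X n i = X n n.-1 * (i.+1 == n)%:R.
  have [eqin|neqin] := eqVneq i.+1 n.
    by rewrite mulr1 -[n.-1](congr1 predn eqin).
  by rewrite mulr0 hess // ltn_neqAle neqin /=.
apply/matrixP => i j; rewrite GJGtE.
(* Entry [(i, j)] of [X^T W = W X], from which the terms [k = n] are then split off. *)
have XW_eq_WX := inner_mulX _ mu (p i) (p j).
rewrite (innerC _ _ (p i)) !expand in XW_eq_WX.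
rewrite !(inner_suml _ _ mu_mom _ (X^~ _) p) !big_ord_recr /= in XW_eq_WX.
rewrite !last_row in XW_eq_WX.
rewrite !mxE.
under eq_bigr do rewrite !truncE.
under [X in _ - X]eq_bigr do rewrite !truncE mulrC.
rewrite /gram (innerC _ _ (p i) (p n)) (innerC _ _ (p j) (p n)).
move: XW_eq_WX; rewrite /itr.
under [X in _ = X + _ -> _]eq_bigr do rewrite innerC.
move=> /eqP; rewrite -subr_eq0 => /eqP XW_eq_WX.
(* Both identities now say that a difference is 0, and the two differences agree up to
   rearrangement. *)
apply/eqP; rewrite -subr_eq0 -[X in _ == X]XW_eq_WX; apply/eqP.
ring.
Qed.
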